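(* Let $G,G'$ be connected distance-regular graphs of positive diameter, with arbitrary roots $a\in V(G)$, $a'\in V(G')$. The following are equivalent: (i) $G$ and $G'$ have the same intersection array; (ii) $s_j(G,a)=s_j(G',a')$ for all $j\ge0$; (iii) all principal adjacency--degree moments of $(G,a)$ and $(G',a')$ are equal. Moreover, for $L\ge1$, if $G$ and $G'$ both have diameter at most $L$, then the equalities $s_j(G,a)=s_j(G',a')$ for $0\le j\le 2L-1$ already imply that $G$ and $G'$ have the same intersection array.
   Context: All graphs are finite and simple. For a distance-regular graph of valency $d$ and diameter $D$, the intersection numbers $b_i,c_i,a_i$ are the numbers of neighbours, at distance $i+1$, $i-1$, $i$ respectively from a root, of a vertex at distance $i$ from the root; the intersection array is the collection of these numbers, $\{b_0,\ldots,b_{D-1};c_1,\ldots,c_D\}$. For a connected regular graph $G$ with at least two vertices and $a\in V(G)$, let $B=A(G-a)$ be the adjacency matrix of the vertex-deleted graph, $D(G-a)$ its diagonal degree matrix, and $\mathbf 1$ the all-ones vector on $V(G)\setminus\{a\}$. The scalar adjacency moments are $s_j(G,a)=\mathbf 1^{\mathsf T}B^j\mathbf 1$, $j\ge0$. A principal adjacency--degree moment is a number $\mathbf 1^{\mathsf T}w(B,D(G-a))\mathbf 1$, where $w$ is a word in two noncommuting variables, including the empty word; equality of all such moments for $(G,a)$ and $(G',a')$ means equality for every word $w$. *)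

(* Defs.v *)
From HB Require Import structures.
From mathcomp Require Import all_boot all_order all_algebra.

Set Implicit Arguments.
Unset Strict Implicit.
Unset Printing Implicit Defensive.

Import GRing.Theory Num.Theory.

Local Open Scope ring_scope.

Record sgraph := SGraph {
  vertex :> finType;
  adj : rel vertex;
  adj_sym : symmetric adj;
  adj_irrefl : irreflexive adj
}.

Section Distance.
Variable G : sgraph.
Local Open Scope nat_scope.

Definition connected : Prop := forall x y : G, connect (@adj G) x y.

(* The least length of a walk from x to y. Walks of length at least #|G| need
   not be searched; the value is #|G| when y is not reachable from x, which
   does not happen in a connected graph. *)
Definition gdist (x y : G) : nat :=
  find (fun n => [exists p : n.-tuple G, path (@adj G) x p && (last x p == y)])
       (iota 0 #|G|).

Definition diameter : nat := \max_(x : G) \max_(y : G) gdist x y.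

(* Numbers of neighbours z of y that are one step further from the root x
   than y, one step closer, and at the same distance. *)
Definition nb_farther (x y : G) : nat :=
  #|[set z | adj y z & gdist x z == (gdist x y).+1]|.
Definition nb_closer (x y : G) : nat :=
  #|[set z | adj y z & (gdist x z).+1 == gdist x y]|.
Definition nb_level (x y : G) : nat :=
  #|[set z | adj y z & gdist x z == gdist x y]|.

(* Meant for connected graphs, where all the distances are finite. *)
Definition distance_regular : Prop :=
  forall x y x' y' : G, gdist x y = gdist x' y' ->
    [/\ nb_farther x y = nb_farther x' y',
        nb_closer x y = nb_closer x' y' &
        nb_level x y = nb_level x' y'].

(* The value of f at some pair of vertices at distance i. In a connected graph
   such a pair exists for all i <= diameter, and if the graph is
   distance-regular the choice is irrelevant for the three functions above. *)
Definition at_distance (f : G -> G -> nat) (i : nat) : nat :=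
  if [pick p : G * G | gdist p.1 p.2 == i] is Some p then f p.1 p.2 else 0.

Definition intersection_b : nat -> nat := at_distance nb_farther.
Definition intersection_c : nat -> nat := at_distance nb_closer.

(* {b_0, ..., b_(D-1); c_1, ..., c_D}; the a_i = b_0 - b_i - c_i are left out
   of the array, as is customary. *)
Definition intersection_array : seq nat * seq nat :=
  ([seq intersection_b i | i <- iota 0 diameter],
   [seq intersection_c i | i <- iota 1 diameter]).

End Distance.

Section VertexDeletion.
Variables (G : sgraph) (a : G).

Definition del_adj : rel {x : G | x != a} := fun x y => adj (val x) (val y).

Lemma del_adj_sym : symmetric del_adj.
Proof. by move=> x y; apply: adj_sym. Qed.

Lemma del_adj_irrefl : irreflexive del_adj.
Proof. by move=> x; apply: adj_irrefl. Qed.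

Definition del_vertex : sgraph := SGraph del_adj_sym del_adj_irrefl.

End VertexDeletion.

(* Matrices are indexed by 'I_#|G| through the enumeration of the vertices. *)
Definition adj_mx (R : realFieldType) (G : sgraph) : 'M[R]_#|G| :=
  \matrix_(i, j) (adj (enum_val i) (enum_val j))%:R.

Definition degree (G : sgraph) (x : G) : nat := #|[set y | adj x y]|.

Definition degree_mx (R : realFieldType) (G : sgraph) : 'M[R]_#|G| :=
  diag_mx (\row_i (degree (enum_val i))%:R).

Definition ones_form (R : realFieldType) (n : nat) (M : 'M[R]_n) : R :=
  ((const_mx 1 : 'cV[R]_n)^T *m M *m (const_mx 1 : 'cV[R]_n)) ord0 ord0.

Definition adj_moment (R : realFieldType) (G : sgraph) (a : G) (j : nat) : R :=
  ones_form (adj_mx R (del_vertex a) ^+ j).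

Inductive letter : Type := LetterAdj | LetterDeg.

Definition letter_mx (R : realFieldType) (G : sgraph) (l : letter) :
    'M[R]_#|G| :=
  match l with LetterAdj => adj_mx R G | LetterDeg => degree_mx R G end.

Definition adj_deg_moment (R : realFieldType) (G : sgraph) (a : G)
    (w : seq letter) : R :=
  ones_form (\prod_(l <- w) letter_mx R (del_vertex a) l).

(* Main.v *)
Require Import Defs.
From HB Require Import structures.
From mathcomp Require Import all_boot all_order all_algebra.
From mathcomp Require Import zify ring.

(** Write S_i for the indicator of the vertices at distance i from the root a,
    as a vector on G - a, and k_i for their number. On radial vectors, whose
    entries depend only on the distance to a, both B = A(G - a) and the degree
    matrix act through the intersection numbers: B is tridiagonal with entries
    c_i, a_i, b_i (lemma [adj_mx_radial]), and the degree is b_0, minus one on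
    the neighbours of a. Since k_(i+1) c_(i+1) = k_i b_i, the k_i are determined
    by the array as well, so the array determines every adjacency-degree moment
    ([array_adj_deg_moment]); the scalar adjacency moments are among these.

    Conversely, suppose that both diameters are at most L and that the moments
    s_0, ..., s_(2L-1) agree. Call two vectors u on G - a and u' on G' - a' a
    Krylov pair of degree m if they are the same linear combination of the
    vectors B^i 1, i <= m, in the two graphs. As B is symmetric, inner products
    of pairs of degrees m and p are given by the moments of order at most m + p,
    so they agree as long as m + p < 2L ([krylov_pair_dot]). Now

    - s_0 and s_1 give the valency, and S_1 = b_0 1 - B 1 because deleting a
      costs exactly the neighbours of a one edge; so the vectors S_1 of the two
      graphs form a Krylov pair of degree 1;
    - if the S_i form a Krylov pair of degree i < L, then k_i = <S_i, S_i> and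
      k_i a_i = <S_i, B S_i> agree, hence so does b_i = b_0 - a_i - c_i;
    - the vector B S_i - a_i S_i - b_(i-1) S_(i-1) is c_(i+1) S_(i+1). Its
      squared norm c_(i+1)^2 k_(i+1) = c_(i+1) k_i b_i gives c_(i+1) and makes
      the S_(i+1) a Krylov pair of degree i + 1. The norm is out of reach of the
      given moments only if i + 1 = L is the diameter of both graphs; there
      k_L is what is left of s_0 = k_1 + ... + k_L, and c_L = k_(L-1) b_(L-1) / k_L.

    The recursion stops at the same place in both graphs, because b_i = 0
    exactly from the diameter on. With L the larger of the two diameters this
    also shows that the full sequence of moments determines the array. *)

Set Implicit Arguments.
Unset Strict Implicit.
Unset Printing Implicit Defensive.

Import Order.TTheory GRing.Theory Num.Theory.

(** * Distances in a connected graph *)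

Section Distances.
Variable G : sgraph.
Implicit Types x y z : G.

Lemma gdist_path_le x p : path (@adj G) x p -> gdist x (last x p) <= size p.
Proof.
move=> xp; rewrite leqNgt; apply/negP => lt_p.
have szp : size p < #|G|.
  apply: leq_trans lt_p _; rewrite /gdist -[leqRHS](size_iota 0); exact: find_size.
have /negP[] := negbT (before_find 0 lt_p); rewrite nth_iota // add0n.
by apply/existsP; exists (in_tuple p); rewrite /= xp eqxx.
Qed.

Hypothesis conG : connected G.

(** A walk shortened to a path has fewer than #|G| steps, so that the bounded
    search that defines the distance succeeds. *)
Lemma gdist_path x y :
  exists p, [/\ path (@adj G) x p, last x p = y & size p = gdist x y].
Proof.
pose P n := [exists p : n.-tuple G, path (@adj G) x p && (last x p == y)].
have hasP : has P (iota 0 #|G|).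
  have /connectP[p xp lp] := conG x y.
  case: (shortenP xp) lp => q xq uq _ lq.
  apply/hasP; exists (size q).
    rewrite mem_iota add0n /=.
    by have := max_card (mem (x :: q)); rewrite (card_uniqP uq).
  by apply/existsP; exists (in_tuple q); rewrite /= xq lq eqxx.
have := nth_find 0 hasP; rewrite nth_iota ?add0n; last first.
  by rewrite -[ltnRHS](size_iota 0) -has_find.
by case/existsP=> p /andP[xp /eqP lp]; exists p; rewrite size_tuple.
Qed.

Lemma gdistxx x : gdist x x = 0.
Proof. by apply/eqP; rewrite -leqn0; apply: (@gdist_path_le x [::]). Qed.

Lemma gdist_eq0 x y : (gdist x y == 0) = (x == y).
Proof.
apply/eqP/eqP => [d0|<-]; last exact: gdistxx.
by have [[|z p] [_ lp]] := gdist_path x y; rewrite d0.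
Qed.

Lemma gdist_adj x y z : adj y z -> gdist x z <= (gdist x y).+1.
Proof.
move=> yz; have [p [xp lp sp]] := gdist_path x y.
have := @gdist_path_le x (rcons p z).
by rewrite rcons_path lp xp yz last_rcons size_rcons sp; apply.
Qed.

Lemma gdist_pred x y n :
  gdist x y = n.+1 -> exists2 z, adj z y & gdist x z = n.
Proof.
move=> dxy; have [p [xp lp sp]] := gdist_path x y.
case: (lastP p) => [|q z] in xp lp sp *; first by rewrite dxy in sp.
rewrite last_rcons in lp; rewrite lp in xp sp => {z lp}.
rewrite rcons_path in xp; case/andP: xp => xq adj_y.
exists (last x q) => //; rewrite size_rcons dxy in sp.
have := gdist_path_le xq; have := gdist_adj x adj_y; lia.
Qed.

Lemma gdist_onto x y i : i <= gdist x y -> exists z, gdist x z = i.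
Proof.
move Dn: (gdist x y) => n; elim: n y Dn => [|n IH] y dxy le_i.
  by exists y; lia.
move: le_i; rewrite leq_eqVlt => /predU1P[->|]; first by exists y.
by have [z _ dxz] := gdist_pred dxy; apply: IH dxz.
Qed.

Lemma gdist_diameter x y : gdist x y <= diameter G.
Proof.
apply: (leq_trans _ (bigop.leq_bigmax (F := fun x : G => \max_y gdist x y) x)).
exact: (bigop.leq_bigmax (F := gdist x)).
Qed.

Lemma diameter_attained x0 : exists x y : G, gdist x y = diameter G.
Proof.
have G_gt0 : 0 < #|G| by apply/card_gt0P; exists x0.
have [x Dx] := bigop.eq_bigmax (fun x : G => \max_y gdist x y) G_gt0.
have [y Dy] := bigop.eq_bigmax (gdist x) G_gt0.
exists x, y; rewrite -Dy; exact/esym.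
Qed.

End Distances.

(** * Intersection numbers and sphere sizes *)

Section DistanceRegular.
Variable G : sgraph.
Hypotheses (conG : connected G) (drG : distance_regular G).
Implicit Types a x y z : G.

Definition intersection_a : nat -> nat := at_distance (@nb_level G).

Definition valency : nat := intersection_b G 0.

Definition sphere_card a (i : nat) : nat := #|[set x | gdist a x == i]|.

Lemma at_distanceE (f : G -> G -> nat) x y :
    (forall u v u' v', gdist u v = gdist u' v' -> f u v = f u' v') ->
  at_distance f (gdist x y) = f x y.
Proof.
move=> fP; rewrite /at_distance; case: pickP => [[u v] /eqP /= /fP //|].
by move=> /(_ (x, y)); rewrite eqxx.
Qed.

Lemma intersection_bE x y : intersection_b G (gdist x y) = nb_farther x y.
Proof. by apply: at_distanceE => u v u' v' /drG[]. Qed.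

Lemma intersection_cE x y : intersection_c G (gdist x y) = nb_closer x y.
Proof. by apply: at_distanceE => u v u' v' /drG[]. Qed.

Lemma intersection_aE x y : intersection_a (gdist x y) = nb_level x y.
Proof. by apply: at_distanceE => u v u' v' /drG[]. Qed.

Lemma at_distance_big (f : G -> G -> nat) i :
  diameter G < i -> at_distance f i = 0.
Proof.
move=> lt_i; rewrite /at_distance; case: pickP => // -[u v] /eqP /= duv.
by have := gdist_diameter u v; lia.
Qed.

Lemma degree_valency x : degree x = valency.
Proof.
rewrite /valency -(gdistxx x) intersection_bE /nb_farther /degree.
apply: eq_card => z; rewrite !inE gdistxx.
case xz: (adj x z) => //=; apply/esym/eqP.
have := gdist_adj conG x xz; rewrite gdistxx.
have : gdist x z != 0.
  by rewrite gdist_eq0 //; apply: contraTneq xz => ->; rewrite adj_irrefl.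
by case: (gdist x z) => [|[]].
Qed.

Lemma adj_gdist_cases a y z : adj y z ->
  [|| (gdist a z).+1 == gdist a y, gdist a z == gdist a y
    | gdist a z == (gdist a y).+1].
Proof.
move=> yz; have := gdist_adj conG a yz; have := @gdist_adj _ conG a z y.
by rewrite adj_sym => /(_ yz); lia.
Qed.

Lemma nb_sum a y : nb_closer a y + nb_level a y + nb_farther a y = degree y.
Proof.
have cardE (P : pred G) : #|[set z | P z]| = \sum_z P z.
  by rewrite -sum1dep_card big_mkcond; apply: eq_bigr => z _; case: (P z).
rewrite /nb_closer /nb_level /nb_farther /degree !cardE -!big_split.
apply: eq_bigr => z _ /=.
case yz: (adj y z) => //=; have := adj_gdist_cases a yz.
by do 3!case: eqP; lia.
Qed.

Lemma sphere0_card a : sphere_card a 0 = 1.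
Proof.
rewrite /sphere_card -(cards1 a); apply: eq_card => x.
by rewrite !inE gdist_eq0 // eq_sym.
Qed.

(** Both sides count the edges between the vertices at distance i and those at
    distance i + 1 from a. *)
Lemma sphere_card_rec a i :
  sphere_card a i.+1 * intersection_c G i.+1
    = sphere_card a i * intersection_b G i.
Proof.
have sphere_sum j (f : G -> nat) c :
    (forall x, gdist a x = j -> f x = c) ->
    sphere_card a j * c = \sum_(x | gdist a x == j) f x.
  move=> fc; rewrite /sphere_card -sum1dep_card big_distrl /=.
  by apply: eq_bigr => x /eqP/fc->; rewrite mul1n.
rewrite (sphere_sum _ (fun x => nb_closer a x)); last first.
  by move=> x <-; rewrite intersection_cE.
rewrite (sphere_sum _ (fun x => nb_farther a x)); last first.
  by move=> x <-; rewrite intersection_bE.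
rewrite /nb_closer /nb_farther.
under eq_bigr do rewrite -sum1dep_card.
under [RHS]eq_bigr do rewrite -sum1dep_card.
rewrite !pair_big_dep /= [RHS](reindex (fun p => (p.2, p.1))) /=; last first.
  by exists (fun p => (p.2, p.1)) => -[].
apply: eq_bigl => -[x z] /=; rewrite [adj z x]adj_sym.
case: (adj x z); rewrite ?andbF //=.
by apply/andP/andP => -[/eqP d1 /eqP d2]; split; apply/eqP; lia.
Qed.

(** Along a shortest path between two vertices at maximal distance, the vertex
    at distance i from one end has a neighbour farther away. *)
Lemma intersection_b_gt0 i : G -> i < diameter G -> 0 < intersection_b G i.
Proof.
move=> x0 lt_i; have [x [y dxy]] := diameter_attained x0.
have [z dxz] : exists z, gdist x z = i.+1.
  by apply: (gdist_onto conG (y := y)); rewrite dxy.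
have [w wz dxw] := gdist_pred conG dxz.
rewrite -dxw intersection_bE; apply/card_gt0P; exists z.
by rewrite inE wz dxz dxw eqxx.
Qed.

Lemma intersection_c_gt0 i :
  G -> 0 < i <= diameter G -> 0 < intersection_c G i.
Proof.
case: i => // i x0 lt_i; have [x [y dxy]] := diameter_attained x0.
have [z dxz] : exists z, gdist x z = i.+1.
  by apply: (gdist_onto conG (y := y)); rewrite dxy.
have [w wz dxw] := gdist_pred conG dxz.
rewrite -dxz intersection_cE; apply/card_gt0P; exists w.
by rewrite inE adj_sym wz dxz dxw eqxx.
Qed.

Lemma intersection_b_diameter i :
  diameter G <= i -> intersection_b G i = 0.
Proof.
move=> le_i; rewrite /intersection_b /at_distance.
case: pickP => // -[x y] /eqP /= dxy; apply: eq_card0 => z; rewrite inE.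
by have := gdist_diameter x z; case: eqP; rewrite ?andbF //; lia.
Qed.

Lemma intersection_c0 : intersection_c G 0 = 0.
Proof.
rewrite /intersection_c /at_distance.
case: pickP => // -[x y] /eqP /= dxy; apply: eq_card0 => z; rewrite inE dxy.
by rewrite andbF.
Qed.

Lemma intersection_c1 : G -> 0 < diameter G -> intersection_c G 1 = 1.
Proof.
move=> x0 D_gt0; have [x [y dxy]] := diameter_attained x0.
have [z dxz] : exists z, gdist x z = 1 by apply: (gdist_onto conG (y := y)); rewrite dxy.
rewrite -{1}dxz intersection_cE /nb_closer -(cards1 x); apply: eq_card => w.
rewrite !inE dxz eqSS gdist_eq0 // [w == x]eq_sym.
case: eqVneq => [<-|]; rewrite ?andbF // andbT.
by have [u uz /eqP] := gdist_pred conG dxz; rewrite gdist_eq0 // adj_sym => /eqP->.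
Qed.

Lemma intersection_sum i : G -> i <= diameter G ->
  intersection_c G i + intersection_a i + intersection_b G i = valency.
Proof.
move=> x0 le_i; have [x [y dxy]] := diameter_attained x0.
have [z <-] : exists z, gdist x z = i by apply: (gdist_onto conG (y := y)); rewrite dxy.
by rewrite intersection_aE intersection_bE intersection_cE nb_sum degree_valency.
Qed.

Lemma sphere_card_gt0 a i : i <= diameter G -> 0 < sphere_card a i.
Proof.
elim: i => [|i IH] le_i; first by rewrite sphere0_card.
have := muln_gt0 (sphere_card a i.+1) (intersection_c G i.+1).
rewrite sphere_card_rec muln_gt0 (IH (ltnW le_i)) intersection_b_gt0 //.
by case/esym/andP.
Qed.

Lemma sphere_card_big a i : diameter G < i -> sphere_card a i = 0.
Proof.
move=> lt_i; apply: eq_card0 => x; rewrite inE.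
by apply: contra_leqF lt_i => /eqP <-; apply: gdist_diameter.
Qed.

Lemma sphere1_card a : 0 < diameter G -> sphere_card a 1 = valency.
Proof.
move=> D_gt0; have := sphere_card_rec a 0.
by rewrite intersection_c1 // sphere0_card muln1 mul1n.
Qed.

Lemma valency_le_sphere_sum a : 0 < diameter G ->
  0 < valency <= \sum_(i < diameter G) sphere_card a i.+1.
Proof.
move=> diamG; rewrite intersection_b_gt0 //=.
case: (diameter G) diamG (sphere1_card a diamG) => // d _ <-.
by rewrite big_ord_recl leq_addr.
Qed.

End DistanceRegular.

(** * Pairs of vectors generated in parallel *)

Section Krylov.
Variable R : comNzRingType.
Local Open Scope ring_scope.

Definition dot n (u w : 'cV[R]_n) : R := (u^T *m w) ord0 ord0.

Lemma dotE n (u w : 'cV[R]_n) : dot u w = \sum_i u i ord0 * w i ord0.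
Proof. by rewrite /dot mxE; apply: eq_bigr => i _; rewrite mxE. Qed.

Lemma dotC n (u w : 'cV[R]_n) : dot u w = dot w u.
Proof. by rewrite !dotE; apply: eq_bigr => i _; rewrite mulrC. Qed.

Lemma dotDr n (u v w : 'cV[R]_n) : dot u (v + w) = dot u v + dot u w.
Proof. by rewrite /dot mulmxDr mxE. Qed.

Lemma dotZr n (x : R) (u w : 'cV[R]_n) : dot u (x *: w) = x * dot u w.
Proof. by rewrite /dot -scalemxAr mxE. Qed.

Lemma dotDl n (u v w : 'cV[R]_n) : dot (v + w) u = dot v u + dot w u.
Proof. by rewrite dotC dotDr !(dotC u). Qed.

Lemma dotZl n (x : R) (u w : 'cV[R]_n) : dot (x *: w) u = x * dot w u.
Proof. by rewrite dotC dotZr dotC. Qed.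

Lemma dot_mulmx_sym n (B : 'M[R]_n) (u w : 'cV[R]_n) :
  B^T = B -> dot (B *m u) w = dot u (B *m w).
Proof. by move=> symB; rewrite /dot trmx_mul symB mulmxA. Qed.

Lemma expmx_mul n (B : 'M[R]_n) j (u : 'cV[R]_n) :
  B ^+ j *m (B *m u) = B ^+ j.+1 *m u.
Proof. by rewrite exprSr -[B ^+ j * B]/(B ^+ j *m B) mulmxA. Qed.

Variables (n n' : nat) (B : 'M[R]_n) (B' : 'M[R]_n').
Variables (v : 'cV[R]_n) (v' : 'cV[R]_n').

(** The index bounds the degree: [krylov_pair m u u'] means that some polynomial
    p of degree at most m has u = p(B) v and u' = p(B') v'. Generating the pairs
    by the operations avoids evaluating polynomials at matrices. *)
Inductive krylov_pair : nat -> 'cV[R]_n -> 'cV[R]_n' -> Prop :=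
| KrylovStart : krylov_pair 0 v v'
| KrylovComb m x u u' w w' : krylov_pair m u u' -> krylov_pair m w w' ->
    krylov_pair m (x *: u + w) (x *: u' + w')
| KrylovMul m u u' : krylov_pair m u u' -> krylov_pair m.+1 (B *m u) (B' *m u')
| KrylovWeaken m u u' : krylov_pair m u u' -> krylov_pair m.+1 u u'.

Lemma krylov_pair_le m p u u' :
  (m <= p)%N -> krylov_pair m u u' -> krylov_pair p u u'.
Proof.
move=> /subnK<-; elim: (p - m)%N => // k IH Km; rewrite addSn.
exact/KrylovWeaken/IH.
Qed.

Lemma krylov_pair0 m : krylov_pair m 0 0.
Proof.
apply: (krylov_pair_le (leq0n m)).
by have := KrylovComb (-1) KrylovStart KrylovStart; rewrite !scaleN1r !addNr.
Qed.

Lemma krylov_pairZ m x u u' :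
  krylov_pair m u u' -> krylov_pair m (x *: u) (x *: u').
Proof.
by move=> Ku; have := KrylovComb x Ku (krylov_pair0 m); rewrite !addr0.
Qed.

Lemma krylov_pairB m u u' w w' : krylov_pair m u u' -> krylov_pair m w w' ->
  krylov_pair m (u - w) (u' - w').
Proof.
by move=> Ku Kw; have := KrylovComb (-1) Kw Ku; rewrite !scaleN1r ![- _ + _]addrC.
Qed.

(** If u = f(B) v and w = g(B) v, then <u, w> = <v, (f g)(B) v> by symmetry of B,
    a combination of the moments <v, B^j v> with j <= m + p. The proof moves the
    generating operations of u over to w, then reduces w itself. *)
Lemma krylov_pair_dot N m p u u' w w' :
    B^T = B -> B'^T = B' ->
    (forall j, (j <= N)%N -> dot v (B ^+ j *m v) = dot v' (B' ^+ j *m v')) ->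
    krylov_pair m u u' -> krylov_pair p w w' -> (m + p <= N)%N ->
  dot u w = dot u' w'.
Proof.
move=> symB symB' moments Ku; elim: Ku p w w'.
- move=> p w w' Kw le_p.
  suff /(_ 0%N le_p) : forall j, (j + p <= N)%N ->
      dot v (B ^+ j *m w) = dot v' (B' ^+ j *m w').
    by rewrite !expr0 !mul1mx.
  (* The power j absorbs the factors B that are stripped off w. *)
  elim: Kw => {p w w' le_p}.
  + by move=> j; rewrite addn0; apply: moments.
  + move=> {}m x w w' z z' _ IHw _ IHz j le_j.
    by rewrite !mulmxDr -!scalemxAr !dotDr !dotZr IHw ?IHz.
  + by move=> {}m w w' _ IH j le_j; rewrite !expmx_mul IH // addSnnS.
  + by move=> {}m w w' _ IH j le_j; apply: IH; lia.
- move=> {}m x s s' t t' _ IHs _ IHt p w w' Kw le_p.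
  by rewrite !dotDl !dotZl (IHs _ _ _ Kw) // (IHt _ _ _ Kw).
- move=> {}m s s' _ IH p w w' Kw le_p.
  rewrite !dot_mulmx_sym //; apply: (IH p.+1); first exact: KrylovMul.
  by rewrite addnS.
- by move=> {}m s s' _ IH p w w' Kw le_p; apply: (IH p) => //; lia.
Qed.

End Krylov.

(** * Radial vectors on the vertex-deleted graph *)

Section Radial.
Variables (R : realFieldType) (G : sgraph) (a : G).
Hypotheses (conG : connected G) (drG : distance_regular G).
Local Open Scope ring_scope.

Let D := diameter G.
Let n := #|del_vertex a|.
Let c := intersection_c G.
Let l := @intersection_a G.
Let b := intersection_b G.
Let k := sphere_card a.

Definition orig (i : 'I_n) : G := val (enum_val i : {x : G | x != a}).

Definition radial (f : nat -> R) : 'cV[R]_n := \col_i f (gdist a (orig i)).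

Lemma orig_dist i : (0 < gdist a (orig i) <= D)%N.
Proof.
rewrite gdist_diameter andbT lt0n gdist_eq0 // eq_sym.
exact: (valP (enum_val i : {x : G | x != a})).
Qed.

Lemma sum_del (F : G -> R) :
  \sum_(x : {x : G | x != a}) F (val x) = \sum_(x | x != a) F x.
Proof. by rewrite -(big_sub (fun x => x != a)). Qed.

Lemma sum_orig (F : G -> R) : \sum_i F (orig i) = \sum_(x | x != a) F x.
Proof.
rewrite -sum_del.
exact/esym/(reindex _ (onW_bij _ (@enum_val_bij (del_vertex a)))).
Qed.

Lemma dot_radial f g :
  dot (radial f) (radial g) = \sum_(i < D) (k i.+1)%:R * (f i.+1 * g i.+1).
Proof.
rewrite dotE; under eq_bigr do rewrite !mxE.
rewrite (sum_orig (fun x => f (gdist a x) * g (gdist a x))).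
rewrite (partition_big (fun x => inord (gdist a x) : 'I_D.+1) xpredT) //=.
rewrite big_ord_recl big1 ?add0r => [|x /andP[xa /eqP/(congr1 val)]]; last first.
  rewrite /= inordK ?ltnS ?gdist_diameter // => /eqP.
  by rewrite gdist_eq0 // eq_sym (negPf xa).
apply: eq_bigr => i _.
have xP x : (x != a) && (inord (gdist a x) == lift ord0 i)
    = (gdist a x == i.+1).
  rewrite -val_eqE /= inordK ?ltnS ?gdist_diameter // /bump leq0n add1n.
  case: (gdist a x =P i.+1) => [dx|_]; rewrite ?andbF // andbT.
  by rewrite eq_sym -(gdist_eq0 conG) dx.
rewrite (eq_bigl _ _ xP).
rewrite (eq_bigr (fun=> f i.+1 * g i.+1)) => [|x /eqP-> //].
by rewrite sumr_const /k /sphere_card cardsE mulr_natl.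
Qed.

(** The value 0 at the root keeps the radial functions within those to which
    [adj_mx_radial] below applies. *)
Definition tridiag (c l b : nat -> nat) (f : nat -> R) (i : nat) : R :=
  if i is j.+1 then (c i)%:R * f j + (l i)%:R * f i + (b i)%:R * f i.+1 else 0.

(** Sort the neighbours of x by their distance to a: it differs by at most one
    from that of x. The deleted root would contribute f 0, hence the
    hypothesis. *)
Lemma adj_mx_radial f : f 0%N = 0 ->
  adj_mx R (del_vertex a) *m radial f = radial (tridiag c l b f).
Proof.
move=> f0; apply/colP => i; rewrite !mxE; under eq_bigr do rewrite !mxE.
rewrite (sum_orig (fun y => (adj (orig i) y)%:R * f (gdist a y))).
rewrite [LHS](_ : _ = \sum_y (adj (orig i) y)%:R * f (gdist a y)); last first.
  by rewrite [RHS](bigD1 a) //= gdistxx // f0 mulr0 add0r.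
have := orig_dist i; set x := orig i; case Dx: (gdist a x) => [//|d] _.
rewrite /tridiag -Dx /c /l /b intersection_cE // intersection_aE //.
rewrite intersection_bE //.
have cardE (P : pred G) : (#|[set y | adj x y & P y]|)%:R
    = \sum_y (adj x y)%:R * (P y)%:R :> R.
  rewrite -sum1dep_card natr_sum big_mkcond; apply: eq_bigr => y _.
  by case: (adj x y); case: (P y); rewrite ?mulr0 ?mulr1 ?mul0r.
rewrite /nb_closer /nb_level /nb_farther !cardE !mulr_suml -!big_split /=.
apply: eq_bigr => y _; case xy: (adj x y); rewrite ?mul0r ?addr0 // !mul1r.
have := adj_gdist_cases conG a xy; rewrite Dx eqSS.
case/or3P=> /eqP->; rewrite ?eqxx.
- by rewrite !ltn_eqF // !mul0r !addr0 mul1r.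
- by rewrite gtn_eqF // ltn_eqF // !mul0r addr0 add0r mul1r.
- by rewrite !gtn_eqF // !mul0r !add0r mul1r.
Qed.

(** Deleting the root lowers by one the degrees of exactly its neighbours. *)
Lemma degree_del (i : 'I_n) :
  (degree (enum_val i))%:R = (b 0)%:R - (gdist a (orig i) == 1%N)%:R :> R.
Proof.
rewrite -[b 0%N](degree_valency conG drG (orig i)).
have degE (H : sgraph) (x : H) : (degree x)%:R = \sum_y (adj x y)%:R :> R.
  rewrite /degree -sum1dep_card natr_sum big_mkcond.
  by apply: eq_bigr => y _; case: (adj x y).
rewrite !degE [in RHS](bigD1 a) //=.
rewrite (sum_del (fun y => (adj (orig i) y)%:R)).
have -> : adj (orig i) a = (gdist a (orig i) == 1%N).
  have /andP[d_gt0 _] := orig_dist i.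
  apply/idP/eqP => [adj_a|/(gdist_pred conG)[z z_adj /eqP]]; last first.
    by rewrite gdist_eq0 // adj_sym => /eqP->.
  rewrite adj_sym in adj_a.
  by have := gdist_adj conG a adj_a; rewrite gdistxx //; lia.
by rewrite addrAC subrr add0r.
Qed.

(** The intersection numbers are parameters here, so that a word acts on radial
    functions by a formula that mentions no graph. *)
Definition letter_radial (c l b : nat -> nat) (w : letter) (f : nat -> R) :
    nat -> R :=
  match w with
  | LetterAdj => tridiag c l b f
  | LetterDeg => fun i => ((b 0)%:R - (i == 1%N)%:R) * f i
  end.

Definition off_root (i : nat) : R := (i != 0%N)%:R.

Definition word_radial (c l b : nat -> nat) (w : seq letter) : nat -> R :=
  foldr (letter_radial c l b) off_root w.

Lemma ones_radial : const_mx 1 = radial off_root.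
Proof.
by apply/colP => i; rewrite !mxE /off_root -lt0n; case/andP: (orig_dist i) => ->.
Qed.

Lemma word_mul_ones w :
  (\prod_(x <- w) letter_mx R (del_vertex a) x) *m radial off_root
    = radial (word_radial c l b w).
Proof.
elim: w => [|x w IH]; first by rewrite big_nil mul1mx.
rewrite big_cons -[_ * _]/(_ *m _) -mulmxA IH /=.
have f0 : word_radial c l b w 0 = 0.
  elim: w {IH} => [|[] w IH] //=.
  by rewrite IH mulr0.
case: x => /=; first exact: adj_mx_radial.
by apply/colP => i; rewrite /degree_mx mul_diag_mx !mxE degree_del.
Qed.

Lemma adj_deg_moment_radial w : adj_deg_moment R a w =
  \sum_(i < D) (k i.+1)%:R * (word_radial c l b w i.+1).
Proof.
rewrite /adj_deg_moment /ones_form -mulmxA ones_radial word_mul_ones.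
by rewrite -/(dot _ _) dot_radial; apply: eq_bigr => i _; rewrite mul1r.
Qed.

Definition sphere (i : nat) : 'cV[R]_n := radial (fun j => (j == i)%:R).

(** The root has been deleted, so no coordinate is at distance 0; this makes the
    recursion in [adj_mx_sphere] uniform. *)
Lemma sphere0 : sphere 0 = 0.
Proof.
by apply/colP => i; rewrite !mxE; case: (gdist a (orig i)) (orig_dist i).
Qed.

Lemma dot_sphere i j : (0 < i <= D)%N ->
  dot (sphere i) (sphere j) = (k i)%:R * (i == j)%:R.
Proof.
case: i => // i /= lt_i; rewrite dot_radial (bigD1 (Ordinal lt_i)) //= eqxx mul1r.
rewrite big1 ?addr0 // => i'; rewrite -val_eqE /= eqSS => /negPf->.
by rewrite mul0r mulr0.
Qed.

Lemma adj_mx_sphere i :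
  adj_mx R (del_vertex a) *m sphere i.+1
    = (c i.+2)%:R *: sphere i.+2 + (l i.+1)%:R *: sphere i.+1
      + (b i)%:R *: sphere i.
Proof.
rewrite adj_mx_radial //; apply/colP => x; rewrite !mxE.
case: (gdist a (orig x)) (orig_dist x) => [//|d] _ /=; rewrite !eqSS.
by congr (_ + _ + _); case: eqP => [E|_]; rewrite ?mulr0 // ?E // -E.
Qed.

(** The rows of B sum to the valency, except that the neighbours of the root
    miss the c_1 = 1 edge to it. *)
Lemma adj_mx_ones : (0 < D)%N ->
  adj_mx R (del_vertex a) *m const_mx 1 = (b 0)%:R *: const_mx 1 - sphere 1.
Proof.
move=> D_gt0; rewrite ones_radial adj_mx_radial ?/off_root ?eqxx //; apply/colP => x.
rewrite !mxE; have := orig_dist x.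
case: (gdist a (orig x)) => [//|d] le_d /=.
rewrite eqSS !mulr1.
have := intersection_sum conG drG a (proj2 (andP le_d)).
rewrite -/c -/l -/b /valency -/b => <-; rewrite !natrD.
case: eqP le_d => [-> _|_ _] /=; last by rewrite mulr1 subr0.
by rewrite mulr0 /c intersection_c1 // add0r; ring.
Qed.

Lemma dot_adj_sphere i : (0 < i <= D)%N ->
  dot (sphere i) (adj_mx R (del_vertex a) *m sphere i) = (k i)%:R * (l i)%:R.
Proof.
case: i => // i lt_i; rewrite adj_mx_sphere !dotDr !dotZr !dot_sphere //.
by rewrite eqxx ltn_eqF // gtn_eqF // mulr1 !mulr0 addr0 add0r mulrC.
Qed.

Lemma dot_ones : dot (const_mx 1) (const_mx 1 : 'cV[R]_n)
  = (\sum_(i < D) k i.+1)%:R.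
Proof.
rewrite ones_radial dot_radial natr_sum.
by apply: eq_bigr => i _; rewrite !mulr1.
Qed.

Lemma dot_ones_sphere1 :
  (0 < D)%N -> dot (const_mx 1) (sphere 1) = (b 0)%:R.
Proof.
move=> D_gt0; rewrite -[b 0%N](sphere1_card conG drG a D_gt0).
rewrite ones_radial dot_radial /k.
case: D D_gt0 => // d _; rewrite big_ord_recl big1 => [|i _].
  by rewrite !mulr1 addr0.
by rewrite !mulr0.
Qed.

Lemma dot_adj_ones : (0 < D)%N ->
  dot (const_mx 1) (adj_mx R (del_vertex a) *m const_mx 1)
    = (b 0)%:R * ((\sum_(i < D) k i.+1)%N%:R - 1).
Proof.
move=> D_gt0; rewrite adj_mx_ones // -scaleN1r dotDr !dotZr dot_ones.
by rewrite dot_ones_sphere1 // mulN1r mulrBr mulr1.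
Qed.

Lemma sphere1E : (0 < D)%N -> sphere 1
  = (b 0)%:R *: const_mx 1 - adj_mx R (del_vertex a) *m const_mx 1.
Proof. by move=> D_gt0; rewrite adj_mx_ones // subKr. Qed.

Lemma sphere_next i : (0 < i)%N ->
  (c i.+1)%:R *: sphere i.+1 = adj_mx R (del_vertex a) *m sphere i
    - (l i)%:R *: sphere i - (b i.-1)%:R *: sphere i.-1.
Proof. by case: i => // i _; rewrite adj_mx_sphere addrAC !addrK. Qed.

Lemma adj_momentE j : adj_moment R a j =
  dot (const_mx 1) (adj_mx R (del_vertex a) ^+ j *m const_mx 1).
Proof. by rewrite /adj_moment /ones_form /dot mulmxA. Qed.

Lemma adj_mx_sym : (adj_mx R (del_vertex a))^T = adj_mx R (del_vertex a).
Proof. by apply/matrixP => i j; rewrite !mxE adj_sym. Qed.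

End Radial.

(** * The array determines the moments *)

Section ArrayDeterminesMoments.
Variables (G G' : sgraph) (a : G) (a' : G').
Hypotheses (conG : connected G) (conG' : connected G').
Hypotheses (drG : distance_regular G) (drG' : distance_regular G').
Hypothesis arrayE : intersection_array G = intersection_array G'.

Lemma array_diameter : diameter G = diameter G'.
Proof. by have := congr1 (size \o fst) arrayE; rewrite /= !size_map !size_iota. Qed.

Lemma array_b i : intersection_b G i = intersection_b G' i.
Proof.
have [le_i|lt_i] := leqP (diameter G) i.
  by rewrite !intersection_b_diameter // -array_diameter.
have := congr1 (fun s => nth 0 s.1 i) arrayE.
by rewrite /= !(nth_map 0) ?size_iota -?array_diameter // !nth_iota.
Qed.

Lemma array_c i : intersection_c G i = intersection_c G' i.
Proof.
case: i => [|i]; first by rewrite !intersection_c0.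
have [le_i|lt_i] := leqP (diameter G) i.
  by rewrite /intersection_c !at_distance_big // -array_diameter.
have := congr1 (fun s => nth 0 s.2 i) arrayE.
by rewrite /= !(nth_map 0) ?size_iota -?array_diameter // !nth_iota.
Qed.

Lemma array_a i : intersection_a G i = intersection_a G' i.
Proof.
have [le_i|lt_i] := leqP i (diameter G); last first.
  by rewrite /intersection_a !at_distance_big // -array_diameter.
have := intersection_sum conG drG a le_i.
rewrite array_diameter in le_i; have := intersection_sum conG' drG' a' le_i.
by rewrite /valency !array_b array_c; lia.
Qed.

Lemma array_sphere_card i : sphere_card a i = sphere_card a' i.
Proof.
have [le_i|lt_i] := leqP i (diameter G); last first.
  by rewrite !sphere_card_big // -array_diameter.
elim: i le_i => [|i IH] lt_i; first by rewrite !sphere0_card.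
apply/eqP; rewrite -(@eqn_pmul2r (intersection_c G i.+1)); last first.
  exact: intersection_c_gt0.
by rewrite {2}array_c !sphere_card_rec // array_b IH ?(ltnW lt_i).
Qed.

Lemma array_adj_deg_moment (R : realFieldType) w :
  adj_deg_moment R a w = adj_deg_moment R a' w.
Proof.
rewrite !adj_deg_moment_radial // array_diameter.
apply: eq_bigr => i _; rewrite array_sphere_card; congr (_ * _)%R.
elim: w i.+1 => [|x w IH] j //=.
by case: x => /=; [case: j => //= j|]; rewrite ?array_a ?array_b ?array_c !IH.
Qed.

End ArrayDeterminesMoments.

Lemma adj_moment_word (R : realFieldType) (G : sgraph) (a : G) j :
  adj_moment R a j = adj_deg_moment R a (nseq j LetterAdj).
Proof.
rewrite /adj_moment /adj_deg_moment big_nseq; congr ones_form.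
by elim: j => [|j IH]; rewrite ?expr0 // exprS IH.
Qed.

(** * Finitely many moments determine the array *)

Section MomentsDetermineArray.
Variables (R : realFieldType) (G G' : sgraph) (a : G) (a' : G') (L : nat).
Hypotheses (conG : connected G) (conG' : connected G').
Hypotheses (drG : distance_regular G) (drG' : distance_regular G').
Hypotheses (diamG : 0 < diameter G) (diamG' : 0 < diameter G').
Hypotheses (leDL : diameter G <= L) (leDL' : diameter G' <= L).
Hypothesis moments :
  forall j, j <= 2 * L - 1 -> adj_moment R a j = adj_moment R a' j.
Local Open Scope ring_scope.

Let B := adj_mx R (del_vertex a).
Let B' := adj_mx R (del_vertex a').
Let S := sphere R a.
Let S' := sphere R a'.
Local Notation K := (krylov_pair B B' (const_mx 1) (const_mx 1)).

Lemma krylov_dot m p u u' w w' : K m u u' -> K p w w' ->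
  (m + p <= 2 * L - 1)%N -> dot u w = dot u' w'.
Proof.
apply: krylov_pair_dot; try exact: adj_mx_sym.
by move=> j le_j; rewrite -!adj_momentE; apply: moments.
Qed.

Lemma card_eq : (\sum_(i < diameter G) sphere_card a i.+1
  = \sum_(i < diameter G') sphere_card a' i.+1)%N.
Proof.
apply/eqP; rewrite -(eqr_nat R) -!dot_ones //; apply/eqP.
by apply: krylov_dot (KrylovStart _ _ _ _) (KrylovStart _ _ _ _) _.
Qed.

(** With N the number of vertices of G - a, the moments are s_0 = N and
    s_1 = b_0 (N - 1). They give b_0 unless N = 1, and then b_0 = 1 because
    0 < b_0 <= N. *)
Lemma valency_eq : valency G = valency G'.
Proof.
have := krylov_dot (KrylovStart _ _ _ _) (KrylovMul (KrylovStart _ _ _ _)).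
move=> /(_ ltac:(lia)); rewrite !dot_adj_ones // -card_eq.
have := valency_le_sphere_sum conG drG a diamG.
have := valency_le_sphere_sum conG' drG' a' diamG'; rewrite -card_eq.
set N := (\sum_(i < _) _)%N.
have [->|N_neq1 _ _ /mulIf eqv] := eqVneq N 1%N; first by lia.
by apply/eqP; rewrite -(eqr_nat R); apply/eqP/eqv; rewrite subr_eq0 pnatr_eq1.
Qed.

(** The induction hypothesis. The c_j come one index further than the b_j:
    reaching the spheres of index i uses c_i but not b_i. *)
Definition agree_upto i : Prop :=
  [/\ forall j, (j < i)%N -> intersection_b G j = intersection_b G' j,
      forall j, (j <= i)%N -> intersection_c G j = intersection_c G' j &
      forall j, (j <= i)%N -> K j (S j) (S' j)].

Lemma agree_upto1 : agree_upto 1.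
Proof.
split=> [[|//] _|[|[|//]] _|[|[|//]] _].
- exact: valency_eq.
- by rewrite !intersection_c0.
- by rewrite !intersection_c1.
- by rewrite /S /S' !sphere0 //; apply: krylov_pair0.
rewrite /S /S' !sphere1E // -/(valency G) valency_eq; apply: krylov_pairB.
  by apply/krylov_pairZ/KrylovWeaken/KrylovStart.
exact/KrylovMul/KrylovStart.
Qed.

Section Level.
Variable i : nat.
Hypothesis agree_i : agree_upto i.
Hypothesis ltiL : (i < L)%N.
Hypotheses (leiD : (i <= diameter G)%N) (leiD' : (i <= diameter G')%N).

(** k_j = <S_j, S_j> only involves moments of order 2j < 2L. *)
Lemma level_sphere_card j :
  (0 < j <= i)%N -> sphere_card a j = sphere_card a' j.
Proof.
case/andP=> j_gt0 leji; have [_ _ /(_ j leji) Kj] := agree_i.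
have /(_ ltac:(lia)) := krylov_dot Kj Kj.
rewrite !dot_sphere ?j_gt0 ?(leq_trans leji) // eqxx !mulr1 => /eqP.
by rewrite eqr_nat => /eqP.
Qed.

Hypothesis i_gt0 : (0 < i)%N.

(** k_i a_i = <S_i, B S_i> only involves moments of order 2i + 1 < 2L. *)
Lemma level_a : intersection_a G i = intersection_a G' i.
Proof.
have [_ _ /(_ i (leqnn i)) Ki] := agree_i.
have /(_ ltac:(lia)) := krylov_dot Ki (KrylovMul Ki).
rewrite !dot_adj_sphere ?i_gt0 // -level_sphere_card ?i_gt0 //= => /mulfI eqa.
apply/eqP; rewrite -(eqr_nat R); apply/eqP/eqa.
by rewrite pnatr_eq0 -lt0n sphere_card_gt0.
Qed.

Lemma level_b : intersection_b G i = intersection_b G' i.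
Proof.
have [_ /(_ i (leqnn i)) eqc _] := agree_i.
have := intersection_sum conG drG a leiD.
have := intersection_sum conG' drG' a' leiD'.
by rewrite valency_eq level_a eqc; lia.
Qed.

End Level.

Section NextLevel.
Variable i : nat.
Hypotheses (agree_i : agree_upto i) (i_gt0 : (0 < i)%N).
Hypotheses (ltiD : (i < diameter G)%N) (ltiD' : (i < diameter G')%N).

Let ltiL : (i < L)%N. Proof. exact: leq_trans ltiD leDL. Qed.
Let leiD : (i <= diameter G)%N. Proof. exact: ltnW. Qed.
Let leiD' : (i <= diameter G')%N. Proof. exact: ltnW. Qed.

Lemma krylov_next : K i.+1 ((intersection_c G i.+1)%:R *: S i.+1)
  ((intersection_c G' i.+1)%:R *: S' i.+1).
Proof.
have [eqb _ KS] := agree_i.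
rewrite /S /S' !sphere_next // (level_a agree_i) // eqb ?prednK //.
apply: krylov_pairB; last first.
  by apply/krylov_pairZ/(krylov_pair_le _ (KS i.-1 _)); lia.
apply: krylov_pairB; first by apply/KrylovMul/KS.
by apply/krylov_pairZ/KrylovWeaken/KS.
Qed.

(** When i + 1 < L the norm of [krylov_next] is available. Otherwise i + 1 = L is
    the diameter of both graphs, and k_L is the rest of the vertex count. *)
Lemma level_c : intersection_c G i.+1 = intersection_c G' i.+1.
Proof.
have k_b_gt0 : (0 < sphere_card a i * intersection_b G i)%N.
  by rewrite muln_gt0 sphere_card_gt0 // intersection_b_gt0.
have kb := sphere_card_rec drG a i.
have kb' := sphere_card_rec drG' a' i.
rewrite -(level_b agree_i) // in kb'.
rewrite -(@level_sphere_card i agree_i ltiL leiD leiD' i) ?i_gt0 //= in kb'.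
have [ltiL1|] := ltnP i.+1 L.
  have /(_ ltac:(lia)) := krylov_dot krylov_next krylov_next.
  rewrite !dotZl !dotZr !dot_sphere // !eqxx !mulr1 -!natrM => /eqP.
  rewrite eqr_nat => /eqP.
  rewrite ![(intersection_c _ _ * sphere_card _ _)%N]mulnC kb kb' => /eqP.
  by rewrite eqn_pmul2r // => /eqP.
move=> leLi; have DE : diameter G = i.+1 by lia.
have DE' : diameter G' = i.+1 by lia.
have eqk : sphere_card a i.+1 = sphere_card a' i.+1.
  move: card_eq; rewrite DE DE' !big_ord_recr /=.
  rewrite (eq_bigr (fun j : 'I_i => sphere_card a' j.+1)) => [/addnI //|j _].
  by apply: (level_sphere_card agree_i) => //; rewrite /= ltn_ord.
apply/eqP; rewrite -(@eqn_pmul2l (sphere_card a i.+1)) ?sphere_card_gt0 //.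
by rewrite kb eqk kb'.
Qed.

End NextLevel.

(** The vectors of [krylov_next] are divided by their common factor c_(i+1). *)
Lemma agree_uptoS i : agree_upto i -> (0 < i)%N ->
  (i < diameter G)%N -> (i < diameter G')%N -> agree_upto i.+1.
Proof.
move=> agree_i i_gt0 ltiD ltiD'; have ltiL : (i < L)%N by lia.
have eqc : intersection_c G i.+1 = intersection_c G' i.+1 by apply: level_c.
have eqb : intersection_b G i = intersection_b G' i by apply: level_b => //; lia.
have [eqbs eqcs KS] := agree_i; split=> j.
- by rewrite ltnS leq_eqVlt => /predU1P[->|/eqbs].
- by rewrite leq_eqVlt => /predU1P[->|/eqcs].
rewrite leq_eqVlt => /predU1P[->|/KS //].
have c_neq0 : (intersection_c G i.+1)%:R != 0 :> R.
  by rewrite pnatr_eq0 -lt0n intersection_c_gt0.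
have := krylov_pairZ (intersection_c G i.+1)%:R^-1
  (krylov_next agree_i i_gt0 ltiD ltiD').
by rewrite -eqc !scalerA mulVf // !scale1r.
Qed.

Lemma agree_upto_all i : (0 < i)%N ->
  (i <= diameter G)%N -> (i <= diameter G')%N -> agree_upto i.
Proof.
elim: i => [//|[|i] IH] _ leiD leiD'; first exact: agree_upto1.
by apply: agree_uptoS => //; apply: IH => //; apply: ltnW.
Qed.

(** Up to the smaller diameter m everything agrees. If the diameters differed,
    then m < L and b_m would agree too, but it vanishes in the graph of diameter
    m only. *)
Lemma moments_array : intersection_array G = intersection_array G'.
Proof.
pose m := minn (diameter G) (diameter G'); have m_gt0 : (0 < m)%N by lia.
have agree_m : agree_upto m by apply: agree_upto_all; rewrite ?geq_minl ?geq_minr.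
have b_m : (m < L)%N -> intersection_b G m = intersection_b G' m.
  by move=> ltmL; apply: level_b => //; lia.
have DE : diameter G = diameter G'.
  case: (ltngtP (diameter G) (diameter G')) => // ltD.
    have : (0 < intersection_b G' m)%N by apply: intersection_b_gt0 => //; lia.
    by rewrite -b_m ?intersection_b_diameter //; lia.
  have : (0 < intersection_b G m)%N by apply: intersection_b_gt0 => //; lia.
  by rewrite b_m ?intersection_b_diameter //; lia.
have [eqb eqc _] := agree_m.
rewrite /intersection_array -DE; congr pair; apply/eq_in_map => i;
  rewrite mem_iota => /andP[? ?]; [apply: eqb | apply: eqc]; lia.
Qed.

End MomentsDetermineArray.

(** * The equivalence *)

Theorem theorem5p2 (R : realFieldType) (G G' : sgraph) (a : G) (a' : G')
    (conG : connected G) (conG' : connected G')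
    (drG : distance_regular G) (drG' : distance_regular G')
    (diamG : (0 < diameter G)%N) (diamG' : (0 < diameter G')%N) :
  ((intersection_array G = intersection_array G' <->
      (forall j : nat, adj_moment R a j = adj_moment R a' j))
   /\
   ((forall j : nat, adj_moment R a j = adj_moment R a' j) <->
      (forall w : seq letter, adj_deg_moment R a w = adj_deg_moment R a' w)))
  /\
  (forall L : nat, (1 <= L)%N ->
     (diameter G <= L)%N -> (diameter G' <= L)%N ->
     (forall j : nat, (j <= 2 * L - 1)%N ->
        adj_moment R a j = adj_moment R a' j) ->
     intersection_array G = intersection_array G').
Proof.
have from_moments : (forall j, adj_moment R a j = adj_moment R a' j) ->
    intersection_array G = intersection_array G'.
  move=> moments.
  by apply: (@moments_array R _ _ a a' (maxn (diameter G) (diameter G'))) => //;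
    rewrite ?leq_maxl ?leq_maxr.
have to_words : intersection_array G = intersection_array G' ->
    forall w, adj_deg_moment R a w = adj_deg_moment R a' w.
  by move=> arrayE w; apply: array_adj_deg_moment.
have from_words : (forall w, adj_deg_moment R a w = adj_deg_moment R a' w) ->
    forall j, adj_moment R a j = adj_moment R a' j.
  by move=> words j; rewrite !adj_moment_word.
split; last by move=> L _ leDL leDL' moments; apply: moments_array moments.
split; first by split=> [/to_words/from_words|/from_moments].
by split=> [/from_moments/to_words|/from_words].
Qed.
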